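(* Let $\mathcal{G}=(\mathcal{V},\mathcal{E},\mathbf{W})$ be a connected signed weighted undirected graph with Laplacian $L$, regarded as a resistive network in which line $(i,j)$ has conductance $w_{ij}$. Let $\mathcal{V}_a,\mathcal{V}_b\subset\mathcal{V}$ be non-empty and disjoint, and let $\mathcal{V}_c=\mathcal{V}\setminus(\mathcal{V}_a\cup\mathcal{V}_b)$. Then $g_{\mathrm{eff}}(L,\mathcal{V}_a,\mathcal{V}_b)$ is equal to the total current flow from $\mathcal{V}_a$ to $\mathcal{V}_b$ when each node $i\in\mathcal{V}_a$ is connected to a voltage source with unit potential, each node $i\in\mathcal{V}_b$ is grounded with zero potential, and each node $i\in\mathcal{V}_c$ remains open circuit. That is, if $v\in\mathbb{R}^n$ satisfies $v_i=1$ for $i\in\mathcal{V}_a$, $v_i=0$ for $i\in\mathcal{V}_b$, and $(Lv)_i=0$ for $i\in\mathcal{V}_c$, then $g_{\mathrm{eff}}(L,\mathcal{V}_a,\mathcal{V}_b)=\sum_{i\in\mathcal{V}_a}(Lv)_i$.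
   Context: Graph: $\mathcal{G}=(\mathcal{V},\mathcal{E},\mathbf{W})$ is a simple undirected connected graph with finite node set $\mathcal{V}$, $n=|\mathcal{V}|$, edge set $\mathcal{E}$, $l=|\mathcal{E}|$; each edge $(i,j)$ carries a nonzero real weight $w_{ij}$, positive or negative, and $\mathbf{W}\in\mathbb{R}^{l\times l}$ is the diagonal matrix of edge weights. With the edges arbitrarily oriented, $\mathbf{E}\in\mathbb{R}^{n\times l}$ is the incidence matrix (column of an edge from $i$ to $j$: entry $1$ in row $i$, $-1$ in row $j$, $0$ elsewhere). The Laplacian is $L=\mathbf{E}\mathbf{W}\mathbf{E}^T$ (real symmetric with zero row sums). Network: for a node voltage vector $v\in\mathbb{R}^n$, Kirchhoff's law gives the vector of external current injections $i=Lv$; an open-circuit node has zero injected current; the total current flow from $\mathcal{V}_a$ to $\mathcal{V}_b$ is the sum of the current injections at the nodes of $\mathcal{V}_a$. Effective conductance: for non-empty disjoint $\mathcal{V}_a,\mathcal{V}_b\subset\mathcal{V}$ put $\mathcal{V}_c=\mathcal{V}\setminus(\mathcal{V}_a\cup\mathcal{V}_b)$, $a=|\mathcal{V}_a|$, $b=|\mathcal{V}_b|$, and let $L_{xy}$ be the submatrix of $L$ with rows indexed by $\mathcal{V}_x$ and columns by $\mathcal{V}_y$. Standing assumption: $L_{cc}$ is nonsingular (when $\mathcal{V}_c\neq\emptyset$). Let $L/L_{cc}$ be the Schur complement $$L/L_{cc}=\begin{bmatrix}L_{aa}&L_{ab}\\L_{ab}^T&L_{bb}\end{bmatrix}-\begin{bmatrix}L_{ac}\\L_{bc}\end{bmatrix}L_{cc}^{-1}\begin{bmatrix}L_{ac}^T&L_{bc}^T\end{bmatrix},$$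 with $L/L_{cc}=L$ if $\mathcal{V}_c=\emptyset$. Then $g_{\mathrm{eff}}(L,\mathcal{V}_a,\mathcal{V}_b)=\mathbf{e}_{\mathcal{V}_a}^T(L/L_{cc})\mathbf{e}_{\mathcal{V}_a}$, where $\mathbf{e}_{\mathcal{V}_a}\in\mathbb{R}^{a+b}$ has entries $1$ on $\mathcal{V}_a$ and $0$ on $\mathcal{V}_b$. *)

(* Defs.v *)
From HB Require Import structures.
From mathcomp Require Import all_boot all_order all_algebra.
From mathcomp Require Import reals.

Set Implicit Arguments.
Unset Strict Implicit.
Unset Printing Implicit Defensive.

Import Order.TTheory GRing.Theory Num.Theory.
Local Open Scope ring_scope.

(* A connected simple undirected graph on the nodes 'I_n, with l edges indexed
   by 'I_l and nonzero real weights of either sign. The choice of src and dst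
   for each edge is the arbitrary orientation; edge_inj compares unordered
   endpoint pairs, so it excludes both parallel and antiparallel edges. *)
Record signed_graph (R : realType) (n l : nat) := SignedGraph {
  src : 'I_l -> 'I_n;
  dst : 'I_l -> 'I_n;
  weight : 'I_l -> R;
  edge_irr : forall e, src e != dst e;
  edge_inj : injective (fun e => [set src e; dst e]);
  weight_neq0 : forall e, weight e != 0;
  graph_connected : forall i j,
    connect (fun x y => [exists e, [set src e; dst e] == [set x; y]]) i j
}.

Section Network.
Variables (R : realType) (n l : nat) (G : signed_graph R n l).

Definition incidence : 'M[R]_(n, l) :=
  \matrix_(i < n, e < l)
    (if i == src G e then 1 else if i == dst G e then -1 else 0).

Definition weight_mx : 'M[R]_l := diag_mx (\row_(e < l) weight G e).

Definition laplacian : 'M[R]_n := incidence *m weight_mx *m incidence^T.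

(* Kirchhoff's law: the external currents injected at the nodes when the node
   voltages are v. *)
Definition injected_current (v : 'cV[R]_n) : 'cV[R]_n := laplacian *m v.

End Network.

Section EffectiveConductance.
Variables (R : realType) (n : nat).
Implicit Types (L : 'M[R]_n) (X Y Va Vb : {set 'I_n}).

(* Rows indexed by X and columns by Y, each listed in increasing order. *)
Definition submx_of L X Y : 'M[R]_(#|X|, #|Y|) :=
  \matrix_(i < #|X|, j < #|Y|) L (enum_val i) (enum_val j).

Definition rest Va Vb : {set 'I_n} := ~: (Va :|: Vb).

Definition blocks_ab L Va Vb : 'M[R]_(#|Va| + #|Vb|) :=
  block_mx (submx_of L Va Va) (submx_of L Va Vb)
           (submx_of L Va Vb)^T (submx_of L Vb Vb).

(* The case of an empty Vc needs no separate clause: see schur_rest0. *)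
Definition schur L Va Vb : 'M[R]_(#|Va| + #|Vb|) :=
  let Vc := rest Va Vb in
  blocks_ab L Va Vb
  - col_mx (submx_of L Va Vc) (submx_of L Vb Vc)
    *m invmx (submx_of L Vc Vc)
    *m row_mx (submx_of L Va Vc)^T (submx_of L Vb Vc)^T.

Lemma schur_rest0 L Va Vb :
  rest Va Vb = set0 -> schur L Va Vb = blocks_ab L Va Vb.
Proof.
rewrite /schur => ->; apply/matrixP => i j.
rewrite !mxE [X in _ - X]big1 ?subr0 // => k _.
by have := enum_valP k; rewrite inE.
Qed.

Definition indicator_a Va Vb : 'cV[R]_(#|Va| + #|Vb|) :=
  col_mx (const_mx 1) (const_mx 0).

Definition geff L Va Vb : R :=
  ((indicator_a Va Vb)^T *m schur L Va Vb *m indicator_a Va Vb) 0 0.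

End EffectiveConductance.

(* Main.v *)
Require Import Defs.
From HB Require Import structures.
From mathcomp Require Import all_boot all_order all_algebra.
From mathcomp Require Import reals.

(** Order the nodes by the blocks Va, Vb, Vc.  The hypotheses say that the
    voltage v has blocks 1, 0 and some unknown v_c, and that the current L v
    vanishes on Vc:
      L_ca 1 + L_cc v_c = 0,   so   v_c = - L_cc^-1 L_ca 1.
    Hence the current injected at Va is
      (L v)_a = L_aa 1 + L_ac v_c = (L_aa - L_ac L_cc^-1 L_ca) 1.
    The matrix in parentheses is the aa block of the Schur complement, because
    L_ca = L_ac^T by symmetry of the Laplacian; it is also the only block that
    e_Va sees in the quadratic form defining the effective conductance
    ([geff_aa_block]).  Summing (L v)_a over Va is multiplying on the left by
    the row 1^T, which turns one side into the other.  The argument is one about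
    symmetric matrices ([geff_total_current]); the Laplacian E W E^T is one of
    them. *)

Set Implicit Arguments.
Unset Strict Implicit.
Unset Printing Implicit Defensive.

Import Order.TTheory GRing.Theory Num.Theory.
Local Open Scope ring_scope.

Section Blocks.
Variables (R : realType) (n : nat).
Implicit Types (L : 'M[R]_n) (v : 'cV[R]_n) (X Y Va Vb : {set 'I_n}).

Definition subcol v X : 'cV[R]_#|X| := \col_i v (enum_val i) 0.

Lemma subcol_const v X c :
  (forall i, i \in X -> v i 0 = c) -> subcol v X = const_mx c.
Proof. by move=> vc; apply/colP => i; rewrite !mxE vc ?enum_valP. Qed.

Lemma sum_subcol v X :
  \sum_(i in X) v i 0 = ((const_mx 1 : 'rV_#|X|) *m subcol v X) 0 0.
Proof.
by rewrite mxE big_enum_val; apply: eq_bigr => i _; rewrite !mxE mul1r.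
Qed.

Lemma submx_of_tr L X Y : L^T = L -> (submx_of L X Y)^T = submx_of L Y X.
Proof. by move=> symL; apply/matrixP => i j; rewrite !mxE -{1}symL mxE. Qed.

Lemma sum_three_parts Va Vb (F : 'I_n -> R) : [disjoint Va & Vb] ->
  \sum_i F i =
  \sum_(i in Va) F i + \sum_(i in Vb) F i + \sum_(i in rest Va Vb) F i.
Proof.
move=> dab; rewrite (bigID [in Va :|: Vb]) /= -(bigU _ _ _ dab) /=.
by congr (_ + _); apply: eq_bigl => i; rewrite !inE.
Qed.

Lemma subcol_mulmx L v Va Vb X : [disjoint Va & Vb] ->
  subcol (L *m v) X =
    submx_of L X Va *m subcol v Va + submx_of L X Vb *m subcol v Vb
    + submx_of L X (rest Va Vb) *m subcol v (rest Va Vb).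
Proof.
move=> dab; apply/colP => i; rewrite !mxE (sum_three_parts _ dab).
by congr (_ + _ + _); rewrite big_enum_val; apply: eq_bigr => j _; rewrite !mxE.
Qed.

(** The zero entries of the indicator of Va kill every block of the Schur
    complement but the aa one. *)
Lemma geff_aa_block L Va Vb (Vc := rest Va Vb) :
  geff L Va Vb =
  ((const_mx 1 : 'rV_#|Va|) *m (submx_of L Va Va
     - submx_of L Va Vc *m invmx (submx_of L Vc Vc) *m (submx_of L Va Vc)^T)
   *m (const_mx 1 : 'cV_#|Va|)) 0 0.
Proof.
rewrite /geff /schur /indicator_a -/Vc /blocks_ab tr_col_mx !trmx_const.
rewrite mul_col_mx mul_col_row opp_block_mx add_block_mx mul_row_block.
by rewrite mul_row_col !mul0mx mulmx0 !addr0.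
Qed.

(** When there is no open-circuit node, L_cc is the 0 x 0 matrix, whose
    determinant is 1, so the elimination of v_c covers that case too. *)
Lemma unitmx_dim0 m (A : 'M[R]_m) : m = 0%N -> A \in unitmx.
Proof. by move=> m0; subst m; rewrite unitmxE det_mx00 unitr1. Qed.

(** The open-circuit equations determine the voltage on Vc; substituting it in
    the current injected at Va produces the aa block of the Schur complement. *)
Lemma geff_total_current L v Va Vb (Vc := rest Va Vb) :
  L^T = L -> [disjoint Va & Vb] -> submx_of L Vc Vc \in unitmx ->
  (forall i, i \in Va -> v i 0 = 1) -> (forall i, i \in Vb -> v i 0 = 0) ->
  (forall i, i \in Vc -> (L *m v) i 0 = 0) ->
  geff L Va Vb = \sum_(i in Va) (L *m v) i 0.
Proof.
move=> symL dab Lcc_unit /subcol_const va /subcol_const vb /subcol_const ic.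
have vc : subcol v Vc =
    - (invmx (submx_of L Vc Vc) *m (submx_of L Vc Va *m const_mx 1)).
  move: ic; rewrite (subcol_mulmx _ _ _ dab) va vb mulmx0 addr0 -/Vc.
  by move/eqP; rewrite addrC addr_eq0 => /eqP Lvc; rewrite -mulmxN -Lvc mulKmx.
rewrite geff_aa_block sum_subcol (subcol_mulmx _ _ _ dab) va vb mulmx0 addr0.
by rewrite -/Vc vc submx_of_tr // -mulmxA mulmxBl mulmxN !mulmxA.
Qed.

End Blocks.

Lemma laplacian_sym (R : realType) (n l : nat) (G : signed_graph R n l) :
  (laplacian G)^T = laplacian G.
Proof. by rewrite /laplacian !trmx_mul trmxK tr_diag_mx mulmxA. Qed.

Theorem theorem1 (R : realType) (n l : nat) (G : signed_graph R n l)
  (Va Vb : {set 'I_n}) (v : 'cV[R]_n)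
  (Va_neq0 : Va != set0) (Vb_neq0 : Vb != set0) (disjVab : [disjoint Va & Vb])
  (Lcc_nonsing : rest Va Vb != set0 ->
     submx_of (laplacian G) (rest Va Vb) (rest Va Vb) \in unitmx)
  (v_source : forall i, i \in Va -> v i 0 = 1)
  (v_ground : forall i, i \in Vb -> v i 0 = 0)
  (v_open : forall i, i \in rest Va Vb -> injected_current G v i 0 = 0) :
  geff (laplacian G) Va Vb = \sum_(i in Va) injected_current G v i 0.
Proof.
apply: geff_total_current => //; first exact: laplacian_sym.
have [Vc0 | /Lcc_nonsing //] := eqVneq (rest Va Vb) set0.
by apply: unitmx_dim0; rewrite Vc0 cards0.
Qed.
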